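(* Let $n\in\mathbb{N}$, $n\ge 1$. Any continuous linear functional $x^*$ on $C_{\lim}(\mathbb{R}_+,\mathbb{R}^n)$ can be uniquely represented by $$\langle x^*,x(\cdot)\rangle=\int_0^\infty\langle x(t),d\mu(t)\rangle\qquad\text{for all } x(\cdot)\in C_{\lim}(\mathbb{R}_+,\mathbb{R}^n),$$ where $\mu=(\mu_1,\dots,\mu_n)$ is a vector of signed regular Borel measures $\mu_1,\dots,\mu_n\in\mathscr{M}(\overline{\mathbb{R}}_+)$, and the integral is taken over $\overline{\mathbb{R}}_+=[0,\infty]$ (including the point $t=\infty$).
   Context: $\mathbb{R}_+=[0,\infty)$ and $\overline{\mathbb{R}}_+=[0,\infty]$ with the topology of the extended real line (a compact space). $C_{\lim}(\mathbb{R}_+,\mathbb{R}^n)$ is the Banach space of all continuous functions $x(\cdot):\mathbb{R}_+\to\mathbb{R}^n$ for which $x(\infty):=\lim_{t\to\infty}x(t)\in\mathbb{R}^n$ exists, with the supremum norm $\|\cdot\|_\infty$; each such function is regarded as defined on $[0,\infty]$ with value $x(\infty)$ at $t=\infty$. The Borel algebra on $\overline{\mathbb{R}}_+$ consists of all sets $A\cup E$ with $A$ a Borel subset of $\mathbb{R}_+$ and $E\subseteq\{\infty\}$. $\mathscr{M}(\overline{\mathbb{R}}_+)$ is the set of (finite) signed regular Borel measures on $\overline{\mathbb{R}}_+$ (regular: the total variation is inner regular with respect to compact sets and outer regular with respect to open sets); each such measure is uniquely of the form $\nu+\nu_\infty$ with $\nu$ a signed regular Borel measure on $\mathbb{R}_+$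 and $\nu_\infty$ a signed measure concentrated at $t=\infty$. For a vector of measures, $\int\langle x(t),d\mu(t)\rangle=\sum_{i=1}^n\int x_i(t)\,d\mu_i(t)$. *)

(* Defs.v *)
From HB Require Import structures.
From mathcomp Require Import all_boot all_order all_algebra.
From mathcomp Require Import all_classical all_reals all_analysis.

Set Implicit Arguments.
Unset Strict Implicit.
Unset Printing Implicit Defensive.

Import Order.TTheory GRing.Theory Num.Theory.
Import numFieldNormedType.Exports.

Local Open Scope classical_set_scope.
Local Open Scope ring_scope.

Definition Rplus (R : realType) : Type := set_type [set t : R | 0 <= t].

HB.instance Definition _ (R : realType) := SubType.on (Rplus R).
HB.instance Definition _ (R : realType) := PseudoMetric.on (Rplus R).

Definition eRplus (R : realType) : Type := set_type [set t : \bar R | 0 <= t]%E.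

HB.instance Definition _ (R : realType) := SubType.on (eRplus R).
HB.instance Definition _ (R : realType) := PseudoMetric.on (eRplus R).

Section points.
Context {R : realType}.

Definition Rplus_of (t : R) (t0 : 0 <= t) : Rplus R := exist _ t (mem_set t0).

Definition Rplus0 : Rplus R := Rplus_of (lexx 0).

Definition eRplus_of (t : \bar R) (t0 : (0 <= t)%E) : eRplus R :=
  exist _ t (mem_set t0).

Definition eRplus_fin (t : Rplus R) : eRplus R :=
  @eRplus_of (val t)%:E (set_mem (valP t)).

Definition eRplus_oo : eRplus R := eRplus_of (leey 0).

End points.

HB.instance Definition _ (R : realType) := isPointed.Build (eRplus R) eRplus_oo.

(* Borel sigma-algebra of the (subspace) topology of [0, +oo]. *)
HB.instance Definition _ (R : realType) :=
  Measurable.copy (eRplus R) (g_sigma_algebraType (@open (eRplus R))).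

Lemma eRplusP (R : realType) (t : eRplus R) :
  (exists2 r : R, 0 <= r & val t = r%:E) \/ val t = +oo%E.
Proof.
case: t => -[r| |] /= t0; last by have := set_mem t0.
  by left; exists r => //; have := set_mem t0.
by right.
Qed.

Lemma measurable_eRplus_fin (R : realType) (A : set R) :
  measurable A -> measurable [set t : eRplus R | (EFin @` A) (val t)].
Proof.
have moo : measurable [set t : eRplus R | val t \is a fin_num].
  apply: sub_sigma_algebra; rewrite /=.
  exists [set t | t < +oo]%E; first exact: open_ereal_lt_ereal.
  apply/seteqP; split => t /=; rewrite set_valE;
    by case: (eRplusP t) => [[r _]|] e; rewrite ?e ?(e : sval t = _) ?ltxx ?ltry.
move=> mA; have {mA} : (@measurable_realfun.RGenOInfty.G R).-sigma.-measurable A.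
  by rewrite -measurable_realfun.RGenOInfty.measurableE.
move: A.
suff : <<s @measurable_realfun.RGenOInfty.G R >> `<=`
    [set A | measurable [set t : eRplus R | (EFin @` A) (val t)]] by exact.
apply: smallest_sub; last first.
  move=> _ [x ->]; apply: sub_sigma_algebra.
  exists ([set t | x%:E < t] `&` [set t | t < +oo])%E.
    by apply: openI; [exact: open_ereal_gt_ereal | exact: open_ereal_lt_ereal].
  apply/seteqP; split => t /=; rewrite set_valE.
    case: (eRplusP t) => [[r _]|] e; rewrite ?e ?(e : sval t = _) => -[]// + _.
    by rewrite lte_fin => xr; exists r => //=; rewrite in_itv/= xr.
  move=> [r /=]; rewrite in_itv/= andbT => xr e.
  by rewrite -(e : _ = sval t) lte_fin ltry.
split => /=.
- rewrite (_ : mkset _ = set0) ?measurable0//.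
  by apply/seteqP; split => // t [].
- move=> B mB.
  rewrite (_ : mkset _ = [set t : eRplus R | val t \is a fin_num] `\`
      [set t : eRplus R | (EFin @` B) (val t)]); first exact: measurableD.
  apply/seteqP; split => t /=.
    move=> [r [_ nBr] e]; split; first by rewrite -(e : _ = sval t).
    move=> [s Bs]; rewrite -(e : _ = sval t) => -[sr]; apply: nBr.
    by rewrite -sr.
  move=> [/fineK tE nB]; exists (fine (val t)) => //; split => // Bt.
  by apply: nB; exists (fine (val t)).
- move=> F mF.
  rewrite (_ : mkset _ = \bigcup_i [set t : eRplus R | (EFin @` F i) (val t)]);
    first exact: bigcupT_measurable.
  apply/seteqP; split => t /=.
    by move=> [r [i _ Fir] e]; exists i => //; exists r.
  by move=> [i _ [r Fir e]]; exists r => //; exists i.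
Qed.

(* The Borel sets of [0, +oo] are exactly the sets A `|` E with A a Borel
   subset of [0, +oo[ and E a subset of {+oo}. *)
Lemma measurable_eRplusP (R : realType) (B : set (eRplus R)) :
  measurable B <-> exists A : set R, exists E : set (\bar R),
    [/\ measurable A, A `<=` [set t | 0 <= t], E `<=` [set +oo%E] &
        val @` B = EFin @` A `|` E].
Proof.
split=> [|[A [E [mA A0 Eoo BAE]]]]; last first.
  have -> : B = [set t | (EFin @` A) (val t)] `|` [set t | E (val t)].
    apply/seteqP; split => t /=.
      move=> Bt; have : (val @` B) (val t) by exists t.
      by rewrite BAE.
    move=> AE; have : (val @` B) (val t) by rewrite BAE.
    by move=> [s Bs /val_inj <-].
  apply: measurableU; first exact: measurable_eRplus_fin.
  have [Eo|nEo] := pselect (E +oo%E); last first.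
    rewrite (_ : mkset _ = set0) ?measurable0//.
    by apply/seteqP; split => // t /= /[dup] /Eoo /= -> /nEo.
  rewrite (_ : mkset _ = ~` [set t | (EFin @` [set: R]) (val t)]).
    by apply: measurableC; apply: measurable_eRplus_fin.
  apply/seteqP; split => t /=.
    by move=> /Eoo/= -> [].
  by case: (eRplusP t) => [[r _]|] -> // []; exists r.
suff : <<s @open (eRplus R) >> `<=` [set B | exists A : set R,
    exists E : set (\bar R),
    [/\ measurable A, A `<=` [set t | 0 <= t], E `<=` [set +oo%E] &
        val @` B = EFin @` A `|` E]] by exact.
have mI : measurable [set t : R | 0 <= t].
  by rewrite -set_itvcy; exact: measurable_itv.
have vE := @eRplusP R.
have key (C : set (eRplus R)) : measurable [set r : R | 0 <= r /\ exists2 t, C t & val t = r%:E] ->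
    exists A : set R, exists E : set (\bar R),
    [/\ measurable A, A `<=` [set t | 0 <= t], E `<=` [set +oo%E] &
        val @` C = EFin @` A `|` E].
  move=> mC; exists [set r : R | 0 <= r /\ exists2 t, C t & val t = r%:E].
  exists [set u | u = +oo%E /\ exists2 t, C t & val t = +oo%E]; split => //.
  - by move=> r [].
  - by move=> u [].
  apply/seteqP; split => u /=.
    move=> [t Ct <-]; have [[r r0 tr]|too] := vE t.
      by left; exists r => //; split => //; exists t.
    by right; split => //; exists t.
  by move=> [[r [r0 [t Ct tr]] <-]|[-> [t Ct tr]]]; exists t.
apply: (@subset_trans _ [set C | measurable [set r : R | 0 <= r /\ exists2 t, C t & val t = r%:E]]).
  apply: smallest_sub; last first.
    move=> C [U oU <-] /=.
    rewrite (_ : mkset _ = [set r | 0 <= r] `&` (EFin @^-1` U)).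
      apply: measurableI => //; apply: measurable_realfun.open_measurable.
      by apply: open_comp => // r _; move=> P; exact.
    apply/seteqP; split => r /=.
      by move=> [r0 [t + tr]]; rewrite set_valE/= tr.
    by move=> [r0 Ur]; split => //; exists (@eRplus_of _ r%:E r0).
  split => /=.
  - rewrite (_ : mkset _ = set0) ?measurable0//.
    by apply/seteqP; split => // r /= [_ []].
  - move=> C mC.
    rewrite (_ : mkset _ = [set r | 0 <= r] `\`
      [set r : R | 0 <= r /\ exists2 t, C t & val t = r%:E]);
      first exact: measurableD.
    apply/seteqP; split => r /=.
      move=> [r0 [t [_ nCt] tr]]; split => // -[_ [s Cs sr]]; apply: nCt.
      by rewrite (_ : t = s)//; apply: val_inj; rewrite /= (tr : sval t = _).
    move=> [r0 nC]; split => //; exists (@eRplus_of _ r%:E r0) => //; split => // Cr.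
    by apply: nC; split => //; exists (@eRplus_of _ r%:E r0).
  - move=> F mF.
    rewrite (_ : mkset _ = \bigcup_i
      [set r : R | 0 <= r /\ exists2 t, F i t & val t = r%:E]);
      first exact: bigcupT_measurable.
    apply/seteqP; split => r /=.
      by move=> [r0 [t [i _ Fit] tr]]; exists i => //; split => //; exists t.
    by move=> [i _ [r0 [t Fit tr]]]; split => //; exists t => //; exists i.
by move=> C; exact: key.
Qed.

Section signed_measures.
Local Open Scope ereal_scope.
Context d (T : measurableType d) (R : realType).
Implicit Types nu : {charge set T -> \bar R}.

(* The chosen Hahn decomposition is immaterial on measurable sets: see
   charge_posE and charge_negE. *)
Definition hahn_pair nu :
    {PN : set T * set T | hahn_decomposition nu PN.1 PN.2} :=
  cid (let: ex_intro P (ex_intro N h) := Hahn_decomposition nu in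
       ex_intro (fun PN => hahn_decomposition nu PN.1 PN.2) (P, N) h).

Definition charge_pos nu : {measure set T -> \bar R} :=
  jordan_pos (svalP (hahn_pair nu)).

Definition charge_neg nu : {measure set T -> \bar R} :=
  jordan_neg (svalP (hahn_pair nu)).

Definition total_variation nu : {measure set T -> \bar R} :=
  charge_variation (svalP (hahn_pair nu)).

Lemma charge_posE nu P N (h : hahn_decomposition nu P N) (A : set T) :
  measurable A -> charge_pos nu A = jordan_pos h A.
Proof.
move=> mA; rewrite /charge_pos /=.
have [p _] := Hahn_decomposition_uniq (svalP (hahn_pair nu)) h mA.
by rewrite !jordan_posE !cjordan_posE /crestr0 mem_set// /crestr p.
Qed.

Lemma charge_negE nu P N (h : hahn_decomposition nu P N) (A : set T) :
  measurable A -> charge_neg nu A = jordan_neg h A.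
Proof.
move=> mA; rewrite /charge_neg /=.
have [_ n] := Hahn_decomposition_uniq (svalP (hahn_pair nu)) h mA.
by rewrite !jordan_negE !cjordan_negE /crestr0 mem_set// /crestr n.
Qed.

(* Integral against a signed measure, through its Jordan decomposition. *)
Definition charge_integral nu (f : T -> R) : R :=
  (\int[charge_pos nu]_t f t - \int[charge_neg nu]_t f t)%R.

End signed_measures.

Definition regular_charge (R : realType)
    (nu : {charge set (eRplus R) -> \bar R}) : Prop :=
  forall A : set (eRplus R), measurable A ->
    total_variation nu A = ereal_sup
      [set total_variation nu K | K in [set K | compact K /\ K `<=` A]] /\
    total_variation nu A = ereal_inf
      [set total_variation nu U | U in [set U | open U /\ A `<=` U]].

Definition at_oo (R : realType) : set_system (Rplus R) :=
  filter_from [set: R] (fun M => [set t : Rplus R | M < val t]).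
Arguments at_oo R : clear implicits.

Instance at_oo_filter (R : realType) : ProperFilter (at_oo R).
Proof.
apply: filter_from_proper => [|M _].
  apply: filter_from_filter; first by exists 0.
  move=> M N _ _; exists (Order.max M N) => // t /=.
  by rewrite gt_max => /andP[].
have p : 0 <= Num.max 0 M + 1 by rewrite addr_ge0// le_max lexx.
by exists (Rplus_of p); rewrite /= ltr_pwDr// le_max lexx orbT.
Qed.

Section Clim.
Context (R : realType) (n : nat).
Implicit Types x : Rplus R -> 'rV[R]_n.

Definition Clim_pred : {pred Rplus R -> 'rV[R]_n} :=
  mem [set x | continuous x /\ cvg (x @ at_oo R)].

Lemma Clim_submod_closed : submod_closed Clim_pred.
Proof.
split=> [|a x y]; rewrite !inE.
  by split; [exact: cst_continuous | exact: is_cvg_cst].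
move=> [cx lx] [cy ly]; split; last first.
  by apply: is_cvgD => //; apply: is_cvgZl_tmp.
move=> t; apply: (@cvgD _ _ _ (nbhs t) _ (a \*: x) y); last exact: cy.
by apply: cvgZl_tmp; exact: cx.
Qed.

HB.instance Definition _ :=
  GRing.isSubmodClosed.Build R (Rplus R -> 'rV[R]_n) Clim_pred
    Clim_submod_closed.

Record Clim : Type := MkClim {
  Clim_fun :> Rplus R -> 'rV[R]_n ;
  _ : Clim_fun \in Clim_pred }.

HB.instance Definition _ := [isSub for Clim_fun].
HB.instance Definition _ := [Choice of Clim by <:].
HB.instance Definition _ := [SubChoice_isSubLmodule of Clim by <:].

Lemma Clim_continuous (x : Clim) : continuous (x : Rplus R -> 'rV[R]_n).
Proof. by case: x => x /= /[!inE] -[]. Qed.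

Lemma Clim_cvg (x : Clim) : cvg (x t @[t --> at_oo R]).
Proof. by case: x => x /= /[!inE] -[]. Qed.

Lemma ClimP (x y : Clim) : (forall t, x t = y t) -> x = y.
Proof. by move=> xy; apply/val_inj/funext. Qed.

Lemma Clim_bounded (x : Clim) : has_ubound (range (fun t => `|x t|)).
Proof.
have [M _ xM] : \forall t \near at_oo R, `|x t - lim (x @ at_oo R)| < 1.
  have /cvgrPdist_lt/(_ 1 ltr01) := @Clim_cvg x.
  by apply: filterS => t; rewrite distrC.
pose P := fun r : R => x (insubd Rplus0 r).
have cP : {within `[0, M], continuous P}.
  apply: (@continuous_subspaceW _ _ _ [set t : R | 0 <= t]).
    by move=> r /=; rewrite in_itv/= => /andP[].
  apply/subspace_sigL_continuousP.
  rewrite (_ : sigL _ _ = x); first exact: (@Clim_continuous x).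
  by apply/funext => t; rewrite /sigL/= /P; congr (x _); exact: valKd.
have := compact_bounded (continuous_compact cP (@segment_compact _ _ _)).
move=> [K [_ /(_ (K + 1))]]; rewrite ltrDl ltr01 => /(_ isT) PK.
exists (Num.max (K + 1) (`|lim (x @ at_oo R)| + 1)) => _ [t _ <-].
rewrite le_max; have [tM|Mt] := leP (val t) M.
  apply/orP; left; apply: PK; exists (val t).
    by rewrite /= in_itv/= tM andbT; exact: (set_mem (valP t)).
  by rewrite /P valKd.
apply/orP; right; rewrite -lerBlDl (le_trans (lerB_dist _ _))//.
exact/ltW/xM.
Qed.

(* The norm of 'rV[R]_n is the maximum norm, which induces the same topology
   as any other norm of R^n. *)
Definition Clim_norm (x : Clim) : R := sup (range (fun t => `|x t|)).

Lemma Clim_norm_ub (x : Clim) t : `|x t| <= Clim_norm x.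
Proof. by apply: ub_le_sup; [exact: Clim_bounded | exists t]. Qed.

Lemma Clim_norm_le (x : Clim) (M : R) :
  (forall t, `|x t| <= M) -> Clim_norm x <= M.
Proof.
move=> xM; apply: ge_sup => [|_ [t _ <-]//].
by exists `|x Rplus0|; exists Rplus0.
Qed.

Lemma Clim_normD (x y : Clim) : Clim_norm (x + y) <= Clim_norm x + Clim_norm y.
Proof.
apply: Clim_norm_le => t; apply: le_trans (ler_normD _ _) _.
by apply: lerD; exact: Clim_norm_ub.
Qed.

Lemma Clim_normZ (a : R) (x : Clim) : Clim_norm (a *: x) = `|a| * Clim_norm x.
Proof.
have le b y : Clim_norm (b *: y) <= `|b| * Clim_norm y.
  by apply: Clim_norm_le => t; rewrite normrZ ler_wpM2l// Clim_norm_ub.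
apply/eqP; rewrite eq_le le /=; have [->|a0] := eqVneq a 0.
  by rewrite normr0 mul0r (le_trans _ (Clim_norm_ub _ Rplus0)).
rewrite -ler_pdivlMl ?normr_gt0// -normfV (le_trans _ (le _ _))//.
by rewrite scalerA mulVf// scale1r.
Qed.

Lemma Clim_norm0_eq0 (x : Clim) : Clim_norm x = 0 -> x = 0.
Proof.
move=> x0; apply: ClimP => t; apply/eqP.
by rewrite -normr_le0 -x0 Clim_norm_ub.
Qed.

HB.instance Definition _ :=
  Lmodule_isNormed.Build R Clim Clim_normD Clim_normZ Clim_norm0_eq0.

Lemma Clim_normE (x : Clim) : `|x| = sup (range (fun t => `|x t|)).
Proof. by []. Qed.

Definition Clim_lim (x : Clim) : 'rV[R]_n := lim (x t @[t --> at_oo R]).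

(* Extension of x to [0, +oo] by its limit at +oo; insubd only casts the real
   r, which is nonnegative here, to Rplus R. *)
Definition Clim_ext (x : Clim) (t : eRplus R) : 'rV[R]_n :=
  if val t is r%:E then x (insubd Rplus0 r) else Clim_lim x.

Lemma Clim_ext_fin (x : Clim) t : Clim_ext x (eRplus_fin t) = x t.
Proof. by rewrite /Clim_ext /= valKd. Qed.

Lemma Clim_ext_oo (x : Clim) : Clim_ext x eRplus_oo = Clim_lim x.
Proof. by []. Qed.

(* \sum_i \int x_i(t) dmu_i(t) over [0, +oo], the point +oo included. *)
Definition Clim_integral (mu : 'I_n -> {charge set (eRplus R) -> \bar R})
    (x : Clim) : R :=
  \sum_(i < n) charge_integral (mu i) (fun t => Clim_ext x t ord0 i).

End Clim.

(* Main.v *)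
Require Import Defs.
From HB Require Import structures.
From mathcomp Require Import all_boot all_order all_algebra.
From mathcomp Require Import all_classical all_reals all_analysis.

Import Order.TTheory GRing.Theory Num.Theory.
Import numFieldNormedType.Exports.
Import measurable_realfun.

Local Open Scope classical_set_scope.
Local Open Scope ring_scope.

Set Implicit Arguments.
Unset Strict Implicit.
Unset Printing Implicit Defensive.

(** A function on [0, +oo[ with a limit at +oo is the same thing as a
    continuous function on the compact space [0, +oo], so the theorem is the
    Riesz representation theorem for that space, applied to each of the n
    coordinates: the i-th measure represents the functional sending a scalar
    function f to the value of phi at f times the i-th basis vector
    ([Clim_axis]).  The representation theorem is proved for an arbitrary
    compact pseudometric space T.

    Positive functionals ([riesz_positive]).  Given L positive and additive on
    nonnegative continuous functions, the outer measure of A is the infimum of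
    the sums of L (f k) over the sequences of such functions whose pointwise sum
    is at least 1 on A.  Countable subadditivity is a rearrangement of a double
    series.  A cozero set U = [set x | 0 < h x] is Caratheodory measurable
    ([cozero_caratheodory]): with g n increasing to the indicator function of U,
    a cover f of X is cut into the telescoping pieces f k (g j.+1 - g j), which
    cover the part of X in U, and into f k (1 - g (n k)), which cover the rest;
    the two total costs add up to that of f up to an error which is small when
    the n k are large.  Open sets of T are cozero sets, so all Borel sets are
    measurable.  Slicing a function f horizontally into layers of height c
    gives integral f <= L f, since each layer is at most c on the set where the
    layer beneath is full, and that layer divided by c is a one-function cover
    of this set.  Compactness enters to show that the total mass is exactly
    L 1, by a Dini argument ([daniell_setT]); applying the inequality to N - f
    for a bound N of f then gives the equality.

    Bounded functionals ([riesz_signed]).  For f nonnegative, let the positive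
    part of phi at f be the supremum of phi g over 0 <= g <= f.  It is positive
    and additive, and so is its difference with phi; phi is then represented by
    the difference of two finite measures.

    Uniqueness ([charge_unique]).  If two charges integrate all continuous
    functions alike, moving the negative parts to the other side gives two
    finite measures which do so too.  They agree on every open set by monotone
    convergence, and the open sets form a generating pi-system.

    Regularity ([compact_regular_measure]).  It holds for every finite Borel
    measure on a compact Hausdorff pseudometric space: the sets squeezed
    between a closed and an open set of nearly the same measure form a
    sigma-algebra, and it contains the open sets. *)

(** * Series of nonnegative extended reals *)

(** The enumeration of the pairs does not depend on the double series: it
    turns a sequence of covers into a single cover, and at the same time the
    sum of their costs into the cost of that cover. *)
Lemma nneseries_pair (R : realType) : exists e : nat -> nat * nat,
  forall F : nat -> nat -> \bar R, (forall i j, 0 <= F i j)%E ->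
  (\sum_(k <oo) F (e k).1 (e k).2 = \sum_(i <oo) \sum_(j <oo) F i j)%E.
Proof.
have /card_esym/ppcard_eqP[e] := card_nat2.
exists e => F F0.
have F0' i : (0 <= \sum_(j <oo) F i j)%E by exact: nneseries_ge0.
rewrite !nneseries_esumT//.
under [RHS]eq_esum do rewrite nneseries_esumT//.
rewrite esum_esum// (reindex_esum [set: nat] _ e)//.
rewrite (_ : _ `*`` _ = [set: nat * nat]); first exact: bij.
by apply/seteqP; split => // -[].
Qed.

Lemma eseries_finite (R : realType) (u : nat -> \bar R) n :
  (forall k, (n <= k)%N -> u k = 0)%E ->
  (\sum_(k <oo) u k = \sum_(0 <= k < n) u k)%E.
Proof.
move=> u0; apply/cvg_lim => //; apply: cvg_near_cst.
exists n => // m /= nm; rewrite (big_cat_nat (leq0n n) nm)/=.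
rewrite [X in (_ + X)%E]big_nat_cond.
by rewrite [X in (_ + X)%E]big1 ?adde0// => k /andP[/andP[nk _] _]; exact: u0.
Qed.

(** * Nonnegative continuous functions *)

Section nonneg_continuous.
Context {R : realType} {T : topologicalType}.
Implicit Types f g : T -> R.

Definition cont_ge0 f := continuous f /\ forall x, 0 <= f x.

Lemma cont_ge0_cst (r : R) : 0 <= r -> cont_ge0 (fun=> r).
Proof. by move=> r0; split => //; exact: cst_continuous. Qed.

Lemma cont_ge0D f g : cont_ge0 f -> cont_ge0 g -> cont_ge0 (fun x => f x + g x).
Proof.
move=> [cf f0] [cg g0]; split => [x|x]; last exact: addr_ge0.
by apply: cvgD; [exact: cf|exact: cg].
Qed.

Lemma cont_ge0M f g : cont_ge0 f -> cont_ge0 g -> cont_ge0 (fun x => f x * g x).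
Proof.
move=> [cf f0] [cg g0]; split => [x|x]; last exact: mulr_ge0.
by apply: cvgM; [exact: cf|exact: cg].
Qed.

Lemma cont_ge0B f g : cont_ge0 f -> cont_ge0 g -> (forall x, g x <= f x) ->
  cont_ge0 (fun x => f x - g x).
Proof.
move=> [cf f0] [cg g0] gf; split => [x|x]; last by rewrite subr_ge0.
by apply: cvgB; [exact: cf|exact: cg].
Qed.

Lemma cont_ge0_min f g : cont_ge0 f -> cont_ge0 g ->
  cont_ge0 (fun x => Num.min (f x) (g x)).
Proof.
move=> [cf f0] [cg g0]; split => [x|x]; last by rewrite le_min f0 g0.
exact: (@continuous_min R T f g x (cf x) (cg x)).
Qed.

Lemma cont_ge0_sum (f : nat -> T -> R) n : (forall k, cont_ge0 (f k)) ->
  cont_ge0 (fun x => \sum_(0 <= k < n) f k x).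
Proof.
move=> cf; elim: n => [|n IH].
  by under eq_fun do rewrite big_nil; exact: cont_ge0_cst (lexx 0).
by under eq_fun do rewrite big_nat_recr//=; exact: cont_ge0D.
Qed.

End nonneg_continuous.

Section steep.
Context {R : realType} {T : topologicalType} (h : T -> R).
Hypothesis ch : cont_ge0 h.

(** As n grows, this increases to the indicator function of [set x | 0 < h x];
    at each point the limit is reached after finitely many steps. *)
Definition steep n (x : T) : R := Num.min 1 (n%:R * h x).

Lemma steep_cont_ge0 n : cont_ge0 (steep n).
Proof.
apply: cont_ge0_min; first exact: cont_ge0_cst.
by apply: cont_ge0M => //; exact: cont_ge0_cst.
Qed.

Lemma steep_le1 n x : steep n x <= 1.
Proof. by rewrite /steep ge_min lexx. Qed.

Lemma steep_nd m n x : (m <= n)%N -> steep m x <= steep n x.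
Proof.
move=> mn; rewrite /steep le_min ge_min lexx/= ge_min.
by rewrite ler_wpM2r ?orbT ?ler_nat//; exact: ch.2.
Qed.

Lemma steep_eq0 n x : h x = 0 -> steep n x = 0.
Proof. by move=> hx; rewrite /steep hx mulr0 min_r. Qed.

Lemma steep0 x : steep 0 x = 0.
Proof. by rewrite /steep mul0r min_r. Qed.

Lemma steep_eq1 x : 0 < h x ->
  exists N, forall n, (N <= n)%N -> steep n x = 1.
Proof.
move=> h0; exists (Num.truncn (h x)^-1).+1 => n Nn.
rewrite /steep min_l// -ler_pdivrMr// div1r; apply/ltW.
by rewrite (lt_le_trans (truncnS_gt _))// ler_nat.
Qed.

End steep.

(** * The Daniell outer measure of a positive additive functional *)

Section daniell.
Context {R : realType} {T : ptopologicalType}.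
Variable L : (T -> R) -> R.
Hypothesis L_ge0 : forall f, cont_ge0 f -> 0 <= L f.
Hypothesis LD : forall f g, cont_ge0 f -> cont_ge0 g ->
  L (fun x => f x + g x) = L f + L g.

Lemma cone0 : L (fun=> 0) = 0.
Proof.
have c0 : @cont_ge0 R T (fun=> 0) by exact: cont_ge0_cst (lexx 0).
have /eqP := LD c0 c0.
rewrite (_ : (fun=> 0 + 0) = (fun=> 0)); last first.
  by apply/funext => x; rewrite addr0.
by rewrite -subr_eq subrr eq_sym => /eqP.
Qed.

Lemma coneB f g : cont_ge0 f -> cont_ge0 g -> (forall x, g x <= f x) ->
  L (fun x => f x - g x) = L f - L g.
Proof.
move=> cf cg gf; apply/eqP; rewrite eq_sym subr_eq -LD//; last exact: cont_ge0B.
by apply/eqP; congr L; apply/funext => x; rewrite subrK.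
Qed.

Lemma cone_mono f g : cont_ge0 f -> cont_ge0 g -> (forall x, g x <= f x) ->
  L g <= L f.
Proof.
by move=> cf cg gf; rewrite -subr_ge0 -coneB// L_ge0//; exact: cont_ge0B.
Qed.

Lemma cone_sum (f : nat -> T -> R) n : (forall k, cont_ge0 (f k)) ->
  L (fun x => \sum_(0 <= k < n) f k x) = \sum_(0 <= k < n) L (f k).
Proof.
move=> cf; elim: n => [|n IH].
  by under eq_fun do rewrite big_nil; rewrite big_nil cone0.
under eq_fun do rewrite big_nat_recr//=.
by rewrite big_nat_recr//= LD ?IH//; exact: cont_ge0_sum.
Qed.

Local Open Scope ereal_scope.

Definition continuous_cover (A : set T) : set (nat -> T -> R) :=
  [set f | (forall k, cont_ge0 (f k)) /\
           forall x, A x -> 1 <= \sum_(k <oo) (f k x)%:E].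

(** Covers are countable, so that covers of countably many sets can be merged
    into a cover of their union. *)
Definition daniell (A : set T) : \bar R :=
  ereal_inf [set \sum_(k <oo) (L (f k))%:E | f in continuous_cover A].

Lemma daniell_ge0 A : 0 <= daniell A.
Proof.
apply: le_ereal_inf_tmp => _ [f [cf _] <-]; apply: nneseries_ge0 => k _ _.
by rewrite lee_fin L_ge0.
Qed.

Lemma daniell_le A f : continuous_cover A f ->
  daniell A <= \sum_(k <oo) (L (f k))%:E.
Proof. by move=> cf; apply: ereal_inf_lbound; exists f. Qed.

Lemma daniell_le1 A f : cont_ge0 f -> (forall x, A x -> 1 <= f x)%R ->
  daniell A <= (L f)%:E.
Proof.
move=> cf Af; pose F k := if k is 0%N then f else (fun=> 0%R : R).
have s1 (u : (T -> R) -> R) : u (fun=> 0%R) = 0%R ->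
    \sum_(k <oo) (u (F k))%:E = (u f)%:E.
  move=> u0; rewrite (@eseries_finite _ _ 1) ?big_nat1// => -[//|k _].
  by rewrite /= u0.
rewrite -(s1 L cone0); apply: daniell_le; split => [[|k]//=|x Ax].
  exact: cont_ge0_cst.
by rewrite (s1 (fun f => f x))// lee_fin Af.
Qed.

Lemma daniell0 : daniell set0 = 0.
Proof.
apply/eqP; rewrite eq_le daniell_ge0 andbT -[leRHS]/(0%R%:E) -cone0.
by apply: daniell_le1 => //; exact: cont_ge0_cst.
Qed.

Lemma le_daniell : {homo daniell : A B / A `<=` B >-> A <= B}.
Proof.
move=> A B AB; apply: le_ereal_inf_tmp => _ [f [cf fB] <-].
by apply: daniell_le; split => // x /AB/fB.
Qed.

Lemma daniell_adherent A (e : R) : (0 < e)%R -> daniell A \is a fin_num ->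
  exists2 f, continuous_cover A f &
    \sum_(k <oo) (L (f k))%:E <= daniell A + e%:E.
Proof.
move=> e0 Afin; have [_ [f Af <-] /ltW fe] := lb_ereal_inf_adherent e0 Afin.
by exists f.
Qed.

Lemma daniell_sigma_subadditive : sigma_subadditive daniell.
Proof.
move=> A.
have [[i Ai]|/forallNP Aoo] := pselect (exists i, daniell (A i) = +oo).
  rewrite (eseries_pinfty _ _ Ai) ?leey// => n _.
  by rewrite -ltNye (lt_le_trans _ (daniell_ge0 _)).
apply/lee_addgt0Pr => e e0.
apply: le_trans (epsilon_trick xpredT (fun n => daniell_ge0 (A n)) (ltW e0)).
have /choice[G PG] n : exists f, continuous_cover (A n) f /\
    \sum_(k <oo) (L (f k))%:E <= daniell (A n) + (e / (2 ^ n.+1)%:R)%:E.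
  have [||f ? ?] := @daniell_adherent (A n) (e / (2 ^ n.+1)%:R)%R.
  - by rewrite divr_gt0// ltr0n expn_gt0.
  - by rewrite ge0_fin_numE ?daniell_ge0// ltey; exact/eqP.
  - by exists f.
have cG n k : cont_ge0 (G n k) by exact: (PG n).1.1.
have [p pE] := nneseries_pair R.
apply: (@le_trans _ _ (\sum_(k <oo) (L (G (p k).1 (p k).2))%:E)).
  apply: daniell_le; split => [k//|x [n _ Anx]].
  rewrite (pE (fun i j => (G i j x)%:E)); last first.
    by move=> i j; rewrite lee_fin (cG i j).2.
  apply: le_trans ((PG n).1.2 x Anx) _.
  have G0 k : 0 <= \sum_(j <oo) (G k j x)%:E.
    by apply: nneseries_ge0 => j _ _; rewrite lee_fin (cG k j).2.
  apply: le_trans (nneseries_lim_ge n.+1 (fun k _ _ => G0 k)).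
  by rewrite big_nat_recr//= leeDr// sume_ge0.
rewrite (pE (fun i j => (L (G i j))%:E)); last first.
  by move=> i j; rewrite lee_fin L_ge0.
apply: lee_nneseries => n _ ; last exact: (PG n).2.
by move=> _; apply: nneseries_ge0 => j _ _; rewrite lee_fin L_ge0.
Qed.

(** A cover of X is split between the cozero set and its complement by means
    of a partition of unity.  The cut-off index may depend on the function of
    the cover, which lets the error be summed as a geometric series. *)
Lemma cozero_caratheodory (h : T -> R) : cont_ge0 h -> forall X,
  daniell (X `&` [set x | 0 < h x]%R) + daniell (X `&` ~` [set x | 0 < h x]%R)
    <= daniell X.
Proof.
move=> ch X; apply: le_ereal_inf_tmp => _ [f [cf fX] <-].
apply/lee_addgt0Pr => e e0.
have L0e k : 0 <= (L (f k))%:E by rewrite lee_fin L_ge0.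
apply: le_trans (epsilon_trick xpredT L0e (ltW e0)).
pose g := steep h; have cg n : cont_ge0 (g n) := steep_cont_ge0 ch n.
pose F k j x := (f k x * (g j.+1 x - g j x))%R.
have cF k j : cont_ge0 (F k j).
  apply: cont_ge0M => //; apply: cont_ge0B => // x.
  exact: steep_nd.
have LF k n :
    \sum_(0 <= j < n) (L (F k j))%:E = (L (fun x => f k x * g n x))%R%:E.
  rewrite sumEFin -cone_sum//; congr (L _)%:E; apply/funext => x.
  by rewrite -mulr_sumr telescope_sumr// /g steep0 subr0.
have cfg k n : cont_ge0 (fun x => f k x * g n x)%R by exact: cont_ge0M.
have fgf k n x : (f k x * g n x <= f k x)%R.
  by rewrite ler_piMr ?steep_le1//; exact: (cf k).2.
(* l k is the limit of L (f k * g n) as n tends to infinity, that is, the part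
   of the cost of f k which is spent on the cozero set. *)
pose l k := \sum_(j <oo) (L (F k j))%:E.
have l0 k : 0 <= l k.
  by apply: nneseries_ge0 => j _ _; rewrite lee_fin L_ge0.
have lcvg k : (L (fun x => f k x * g n x))%R%:E @[n --> \oo] --> l k.
  rewrite (_ : (fun n => _) = (fun n => \sum_(0 <= j < n) (L (F k j))%:E)).
    by apply: is_cvg_nneseries => j _ _; rewrite lee_fin L_ge0.
  by apply/funext => n; rewrite LF.
have llf k : l k <= (L (f k))%:E.
  apply: (cvge_le _ (lcvg k)); apply: nearW => n; rewrite lee_fin.
  exact: cone_mono.
have lfin k : l k \is a fin_num.
  by rewrite ge0_fin_numE// (le_lt_trans (llf k))// ltry.
have /choice[n nP] k : exists n,
    l k <= (L (fun x => f k x * g n x) + e / (2 ^ k.+1)%:R)%R%:E.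
  have e'0 : (0 < e / (2 ^ k.+1)%:R)%R by rewrite divr_gt0// ltr0n expn_gt0.
  have : l k - (e / (2 ^ k.+1)%:R)%:E < l k.
    by rewrite lteBlDr// lteDl// lte_fin.
  set a := (X in X < _) => al.
  have : nbhs (l k) [set y | a < y].
    by apply: open_nbhs_nbhs; split => //; exact: open_ereal_gt_ereal.
  move=> /(lcvg k)[N _ /(_ N (leqnn N))/= lN]; exists N.
  by rewrite EFinD -leeBlDr// ltW.
have [p pE] := nneseries_pair R.
(* At a point of the cozero set the pieces F k j sum up to f k. *)
have A1 : daniell (X `&` [set x | 0 < h x]%R) <= \sum_(k <oo) l k.
  rewrite -(pE (fun k j => (L (F k j))%:E)); last first.
    by move=> *; rewrite lee_fin L_ge0.
  apply: daniell_le; split => [k//|x [Xx hx]].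
  rewrite (pE (fun k j => (F k j x)%:E)); last first.
    by move=> i j; rewrite lee_fin (cF i j).2.
  apply: le_trans (fX x Xx) _; apply: lee_nneseries => k _.
    by rewrite lee_fin (cf k).2.
  have [N gN] := steep_eq1 hx.
  rewrite (@eseries_finite _ _ N).
    rewrite sumEFin -mulr_sumr telescope_sumr// /g steep0 subr0.
    by rewrite gN// mulr1.
  by move=> j Nj; rewrite /F /g !gN ?subrr ?mulr0// (leq_trans Nj).
(* Outside the cozero set all the g n vanish. *)
have A2 : daniell (X `&` ~` [set x | 0 < h x]%R) <=
    \sum_(k <oo) (L (f k) - L (fun x => f k x * g (n k) x))%R%:E.
  under eq_eseriesr => k _ do rewrite -coneB//.
  apply: daniell_le; split => [k|x [Xx nhx]].
    exact: cont_ge0B.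
  apply: le_trans (fX x Xx) _; apply: lee_nneseries => k _.
    by rewrite lee_fin (cf k).2.
  rewrite /g steep_eq0 ?mulr0 ?subr0//; apply/eqP.
  by rewrite eq_le ch.2 leNgt andbT; exact/negP.
apply: le_trans (leeD A1 A2) _.
rewrite -nneseriesD//; last first.
  by move=> k _ _; rewrite lee_fin subr_ge0 cone_mono.
apply: lee_nneseries => k _.
  by rewrite adde_ge0// lee_fin subr_ge0 cone_mono.
rewrite -EFinD; apply: le_trans (leeD2r _ (nP k)) _.
by rewrite -EFinD lee_fin addrAC addrCA subrr addr0 addrC.
Qed.

End daniell.

(** * Borel sets and cozero sets of a pseudometric space *)

Lemma contract_continuous (R : realType) : continuous (@contract R).
Proof.
move=> x; apply/cvgrPdist_lt => e e0.
exact: (@nbhsx_ballx R (\bar R) x e e0).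
Qed.

(** The distance to the complement is positive exactly on U.  It can be
    infinite; contract makes it real-valued. *)
Lemma open_cozero (R : realType) (T : pseudoMetricType R) (U : set T) :
  open U -> exists2 h : T -> R, cont_ge0 h & U = [set x | 0 < h x].
Proof.
move=> oU; exists (fun x => contract (edist_inf (~` U) x)).
  split => x; last first.
    by rewrite -(contract0 R) le_contract edist_inf_ge0.
  apply: (@continuous_comp _ _ _ (edist_inf (~` U)) (@contract R)).
    exact: edist_inf_continuous.
  exact: contract_continuous.
apply/seteqP; split => x /=; rewrite -(contract0 R) lt_contract; last first.
  by have [//|nUx] := pselect (U x); rewrite edist_inf0// ltxx.
move=> Ux; have /nbhs_ballP[e /= e0 xeU] : nbhs x U by exact: open_nbhs_nbhs.
apply: (@lt_le_trans _ _ e%:E); first by rewrite lte_fin.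
apply: le_ereal_inf_tmp => _ [a nUa <-]; rewrite leNgt; apply/negP => xa.
by apply: nUa; apply: xeU; exact: (edist_lt_ball xa).
Qed.

Lemma compact_continuous_bound (R : realType) (T : topologicalType)
    (f : T -> R) :
  compact [set: T] -> continuous f -> exists N, forall x, `|f x| <= N%:R.
Proof.
move=> cT cf; have cf' : {within [set: T], continuous f}.
  exact: continuous_subspaceT.
have [K [_ KM]] := compact_bounded (continuous_compact cf' cT).
exists (Num.truncn K).+1 => x; apply: KM; last by exists x.
exact: truncnS_gt.
Qed.

Notation borel T := (g_sigma_algebraType (@open T)).

Lemma open_borel (T : ptopologicalType) (U : set T) :
  open U -> measurable (U : set (borel T)).
Proof. exact: sub_sigma_algebra. Qed.

Lemma closed_borel (T : ptopologicalType) (K : set T) :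
  closed K -> measurable (K : set (borel T)).
Proof.
move=> cK; rewrite -(setCK K); apply: measurableC; apply: open_borel.
by rewrite openC.
Qed.

Lemma continuous_borel (R : realType) (T : ptopologicalType) (f : T -> R) :
  continuous f -> measurable_fun [set: borel T] f.
Proof.
move=> cf.
apply: (measurability _ (measurable_realfun.RGenOInfty.measurableE R)).
move=> _ [_ [x ->] <-]; rewrite setTI; apply: open_borel.
by apply: open_comp => // t _; exact: cf.
Qed.

(** * The representation theorem for positive functionals *)

Section positive.
Context {R : realType} {T : pseudoPMetricType R}.
Variable L : (T -> R) -> R.
Hypothesis L_ge0 : forall f, cont_ge0 f -> 0 <= L f.
Hypothesis LD : forall f g, cont_ge0 f -> cont_ge0 g ->
  L (fun x => f x + g x) = L f + L g.

Lemma daniell_measure :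
  exists mu : {measure set (borel T) -> \bar R}, forall A, mu A = daniell L A.
Proof.
pose om : {outer_measure set T -> \bar R} := HB.pack (daniell L)
  (isOuterMeasure.Build R T (daniell L) (daniell0 L_ge0 LD) (daniell_ge0 L_ge0)
    (@le_daniell _ _ L) (daniell_sigma_subadditive L_ge0)).
have cara : @measurable _ (borel T) `<=` @measurable _ (caratheodory_type om).
  apply: smallest_sub; first exact: sigma_algebra_measurable.
  move=> U oU; have [h ch ->] := open_cozero oU.
  apply: le_caratheodory_measurable => X.
  exact: cozero_caratheodory.
have sa : semi_sigma_additive (daniell L : set (borel T) -> \bar R).
  move=> F mF tF mUF.
  apply: (@caratheodory_measure_sigma_additive R T om) => //.
  - by move=> i; exact: cara.
  - exact: cara.
pose mu : {measure set (borel T) -> \bar R} := HB.pack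
  (daniell L : set (borel T) -> \bar R)
  (isMeasure.Build _ (borel T) R (daniell L) (daniell0 L_ge0 LD)
    (daniell_ge0 L_ge0) sa).
by exists mu.
Qed.


Let c1 : @cont_ge0 R T (fun=> 1) := cont_ge0_cst ler01.

Lemma cone_natmul f n : cont_ge0 f -> L (fun x => n%:R * f x) = n%:R * L f.
Proof.
move=> cf; rewrite !mulr_natl -[n in RHS]subn0 -sumr_const_nat.
rewrite -(cone_sum LD _ (fun=> cf)).
by congr L; apply/funext => x; rewrite sumr_const_nat subn0 mulr_natl.
Qed.

Lemma cone_divn f n : cont_ge0 f ->
  L (fun x => n.+1%:R^-1 * f x) = n.+1%:R^-1 * L f.
Proof.
move=> cf; apply/eqP; rewrite -(inj_eq (@mulfI _ n.+1%:R _))// -cone_natmul.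
  rewrite mulrA divff// mul1r; apply/eqP; congr L; apply/funext => x.
  by rewrite mulrA divff// mul1r.
by apply: cont_ge0M => //; exact: cont_ge0_cst.
Qed.

Hypothesis cT : compact [set: T].

(** This is where compactness is needed: if the sum of the f k is at least 1
    everywhere, then finitely many of them already have a sum greater than
    1 - 1 / m.+1 everywhere. *)
Lemma daniell_setT : daniell L setT = (L (fun=> 1))%:E.
Proof.
apply/eqP; rewrite eq_le; apply/andP; split.
  by apply: daniell_le1 => // x _.
apply: le_ereal_inf_tmp => _ [f [cf f1] <-].
apply/lee_addgt0Pr => e e0.
pose m := Num.truncn (L (fun=> 1) / e).
have mP : m.+1%:R^-1 * L (fun=> 1) <= e.
  by rewrite ler_pdivrMl// -ler_pdivrMr//; apply/ltW/truncnS_gt.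
have [n _ /(_ n (leqnn n)) fn] : \forall n \near \oo,
    [set: T] `<=` (fun x => 1 - m.+1%:R^-1 < \sum_(0 <= k < n) f k x).
  apply: (compact_near_coveringP _).1 => // x _.
  have lt1 : ((1 - m.+1%:R^-1)%R%:E < \sum_(k <oo) (f k x)%:E)%E.
    by apply: lt_le_trans (f1 x I); rewrite lte_fin ltrBlDr ltrDl.
  have [N N1] : exists N, 1 - m.+1%:R^-1 < \sum_(0 <= k < N) f k x.
    have : cvgn (fun n => \sum_(0 <= k < n) (f k x)%:E)%E.
      by apply: is_cvg_nneseries => k _ _; rewrite lee_fin (cf k).2.
    have oN : nbhs (\sum_(k <oo) (f k x)%:E)%E
        [set y | ((1 - m.+1%:R^-1)%R%:E < y)%E].
      by apply: open_nbhs_nbhs; split => //; exact: open_ereal_gt_ereal.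
    move=> /(_ _ oN)[N _ /(_ N (leqnn N))/=].
    by rewrite sumEFin lte_fin; exists N.
  have cN : continuous (fun y => \sum_(0 <= k < N) f k y).
    exact: (cont_ge0_sum N cf).1.
  exists ([set y | 1 - m.+1%:R^-1 < \sum_(0 <= k < N) f k y],
          [set n | (N <= n)%N]).
    split; last by exists N.
    apply: (cN x [set y | 1 - m.+1%:R^-1 < y]).
    by apply: open_nbhs_nbhs; split => //; exact: open_gt.
  move=> [y n] [/= Ny Nn]; apply: lt_le_trans Ny _.
  rewrite (big_cat_nat (leq0n N) Nn)/= lerDl sumr_ge0// => k _.
  exact: (cf k).2.
apply: (@le_trans _ _
  ((L (fun x => \sum_(0 <= k < n) f k x))%:E + e%:E)); last first.
  rewrite cone_sum// -sumEFin leeD2r//; apply: nneseries_lim_ge => k _ _.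
  by rewrite lee_fin L_ge0.
rewrite -EFinD lee_fin; apply: le_trans (lerD (lexx _) mP).
rewrite -cone_divn// -LD//; last 2 first.
- exact: cont_ge0_sum.
- by apply: cont_ge0M => //; exact: cont_ge0_cst.
apply: cone_mono => // [|x].
  apply: cont_ge0D; first exact: cont_ge0_sum.
  by apply: cont_ge0M => //; exact: cont_ge0_cst.
by rewrite mulr1 -lerBlDr; exact/ltW/fn.
Qed.

Section integral.
Local Open Scope ereal_scope.
Variable mu : {measure set (borel T) -> \bar R}.
Hypothesis muE : forall A, mu A = daniell L A.

(** The layer g has height c, and h is at least 1 on its support, so it covers
    that support. *)
Lemma integral_step (g h : T -> R) (c : R) : (0 < c)%R ->
  cont_ge0 g -> cont_ge0 h ->
  (forall x, g x <= c)%R -> (forall x, 0 < g x -> 1 <= h x)%R ->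
  \int[mu]_x (g x)%:E <= (c * L h)%:E.
Proof.
move=> c0 cg ch gc gh; pose A : set (borel T) := [set x | 1 <= h x]%R.
have mA : measurable A.
  apply: closed_borel; apply: (preimage_closed _ (@closed_ge _ 1%R)) => x _.
  exact: ch.1.
have : \int[mu]_x (g x)%:E <= \int[mu]_x (c%:E * (\1_A x)%:E).
  apply: ge0_le_integral => //.
  - by move=> x _; rewrite lee_fin cg.2.
  - apply/measurable_EFinP; exact: (continuous_borel cg.1).
  - by apply: measurable_funeM; apply/measurable_EFinP; exact: measurable_indic.
  - move=> x _; rewrite -EFinM lee_fin indicE.
    have [xA|] := boolP (x \in A); first by rewrite mulr1.
    rewrite notin_setE /A /= => nxA; rewrite mulr0 leNgt; apply/negP => /gh.
    exact: nxA.
move/le_trans; apply.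
rewrite ge0_integralZl//; last 2 first.
- by apply/measurable_EFinP; exact: measurable_indic.
- by rewrite lee_fin ltW.
rewrite integral_indic// setIT EFinM lee_pmul2l// ?lte_fin//.
by rewrite muE; apply: daniell_le1.
Qed.

(** Each layer g j.+1 is supported where the layer g j beneath it is full, so
    its integral is at most L (g j).  Only the bottom layer has nothing
    beneath it; it costs at most c * L 1, hence the choice of c. *)
Lemma integral_le f : cont_ge0 f -> \int[mu]_x (f x)%:E <= (L f)%:E.
Proof.
move=> cf; apply/lee_addgt0Pr => e e0.
pose n := Num.truncn (L (fun=> 1%R) / e).
have nP : (n.+1%:R^-1 * L (fun=> 1%R) <= e)%R.
  by rewrite ler_pdivrMl// -ler_pdivrMr//; apply/ltW/truncnS_gt.
pose c : R := n.+1%:R^-1%R.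
have c0 : (0 < c)%R by rewrite invr_gt0.
have [M fM] : exists M : nat, forall x, (f x <= c * M.+1%:R)%R.
  have [M fM] := compact_continuous_bound cT cf.1.
  exists (Num.truncn (n.+1%:R * M%:R : R)) => x.
  rewrite (le_trans (ler_norm _))// (le_trans (fM x))// ler_pdivlMl//.
  exact/ltW/truncnS_gt.
(* t j is f truncated at height c * j, and g j is the slice of f above it. *)
pose t j x := Num.min (f x) (c * j%:R)%R.
have ct j : cont_ge0 (t j).
  by apply: cont_ge0_min => //; apply: cont_ge0_cst; rewrite mulr_ge0// ltW.
have tS j x : (t j x <= t j.+1 x)%R.
  rewrite /t le_min !ge_min lexx/= (_ : c * j%:R <= c * j.+1%:R)%R ?orbT//.
  by rewrite ler_pM2l// ler_nat.
pose g j x := (t j.+1 x - t j x)%R.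
have cg j : cont_ge0 (g j) by exact: cont_ge0B.
have gc j x : (g j x <= c)%R.
  rewrite /g lerBlDr {2}/t; case: (lerP (f x) (c * j%:R)%R) => _.
    by rewrite (le_trans (_ : (_ <= f x)%R))//
      ?lerDr ?(ltW c0)// /t ge_min lexx.
  by rewrite /t ge_min -nat1r mulrDr mulr1 lexx orbT.
have gg j x : (0 < g j.+1 x -> 1 <= n.+1%:R * g j x)%R.
  have [fj|fj] := lerP (f x) (c * j.+1%:R)%R.
    by rewrite subr_gt0 ltNge /t (min_l fj) ge_min lexx.
  move=> _; rewrite /g /t (min_r (ltW fj)) min_r; last first.
    by rewrite (le_trans _ (ltW fj))// ler_pM2l// ler_nat.
  by rewrite -mulrBr -natrB// subSnn mulr1 divff.
have fg x : (f x = \sum_(0 <= j < M.+1) g j x)%R.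
  rewrite telescope_sumr// /t mulr0 (min_r (cf.2 x)) subr0.
  by rewrite min_l.
have -> : \int[mu]_x (f x)%:E = \sum_(0 <= j < M.+1) \int[mu]_x (g j x)%:E.
  under eq_integral do rewrite fg -sumEFin.
  rewrite ge0_integral_sum// => j.
    by apply/measurable_EFinP; exact: (continuous_borel (cg j).1).
  by move=> x _; rewrite lee_fin (cg j).2.
rewrite big_nat_recl//= addrC; apply: leeD; last first.
  apply: le_trans (_ : (c * L (fun=> 1%R))%:E <= _); last by rewrite lee_fin.
  by apply: integral_step.
apply: (@le_trans _ _ (\sum_(0 <= j < M) (L (g j))%:E)).
  apply: lee_sum => j _.
  rewrite (_ : L (g j) = c * L (fun x => n.+1%:R * g j x))%R.
    apply: integral_step => //.
      by apply: cont_ge0M => //; exact: cont_ge0_cst.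
    exact: gg.
  by rewrite cone_natmul// mulrA mulVf// mul1r.
rewrite sumEFin -cone_sum// lee_fin; apply: cone_mono => // [|x].
  exact: cont_ge0_sum.
by rewrite fg big_nat_recr//= lerDl (cg _).2.
Qed.

Lemma integral_eq f : cont_ge0 f -> \int[mu]_x (f x)%:E = (L f)%:E.
Proof.
move=> cf.
apply/eqP; rewrite eq_le integral_le//=.
have [N fM] := compact_continuous_bound cT cf.1.
pose M : R := N%:R%R.
have cM : @cont_ge0 R T (fun=> M) by exact: cont_ge0_cst.
have fM' x : (f x <= M)%R by rewrite (le_trans (ler_norm _))// fM.
have cMf := cont_ge0B cM cf fM'.
have mE g : cont_ge0 g -> measurable_fun [set: borel T] (fun x => (g x)%:E).
  by move=> cg; apply/measurable_EFinP; exact: (continuous_borel cg.1).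
have LME : \int[mu]_x M%:E = (L (fun=> M))%:E.
  rewrite -/(cst M%:E) integral_cst// muE daniell_setT -EFinM -cone_natmul//.
  by congr (L _)%:E; apply/funext => x; rewrite mulr1.
have : \int[mu]_x (f x)%:E + \int[mu]_x (M - f x)%:E =
    (L f + L (fun x => M - f x))%:E.
  rewrite -ge0_integralD//; last 4 first.
  - by move=> x _; rewrite lee_fin cf.2.
  - exact: mE.
  - by move=> x _; rewrite lee_fin subr_ge0.
  - exact: mE.
  rewrite -LD//; under eq_integral do rewrite -EFinD addrC subrK.
  by rewrite LME; congr (L _)%:E; apply/funext => x; rewrite addrC subrK.
move=> h; have := leeD2l (\int[mu]_x (f x)%:E) (integral_le cMf).
by rewrite h EFinD leeD2rE.
Qed.

End integral.

Theorem riesz_positive : exists mu : {measure set (borel T) -> \bar R},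
  (mu setT < +oo)%E /\
  forall f, cont_ge0 f -> (\int[mu]_x (f x)%:E = (L f)%:E)%E.
Proof.
have [mu muE] := daniell_measure; exists mu; split => [|f cf].
  by rewrite muE daniell_setT ltry.
exact: integral_eq.
Qed.

End positive.

(** * The representation theorem for bounded functionals *)

Section positive_part.
Context {R : realType} {T : topologicalType}.
Variable phi : (T -> R) -> R.
Hypothesis phiD : forall f g, continuous f -> continuous g ->
  phi (fun x => f x + g x) = phi f + phi g.
Variable C : R.
Hypothesis phi_bound : forall f M, continuous f -> (forall x, `|f x| <= M) ->
  `|phi f| <= C * M.
Hypothesis cT : compact [set: T].

Let below f : set R :=
  [set phi g | g in [set g | cont_ge0 g /\ forall x, g x <= f x]].

Definition positive_part f : R := sup (below f).

Let phi0 : phi (fun=> 0) = 0.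
Proof.
have := phiD (@cst_continuous T R 0) (@cst_continuous T R 0).
rewrite (_ : (fun=> _) = (fun=> 0)); last first.
  by apply/funext => x; rewrite /cst addr0.
by move/eqP; rewrite -subr_eq subrr eq_sym => /eqP.
Qed.

Let below0 f : cont_ge0 f -> below f 0.
Proof.
move=> [_ f0]; exists (fun=> 0) => //.
by split => //; exact: (cont_ge0_cst (lexx 0)).
Qed.

Let below_sup f : cont_ge0 f -> has_sup (below f).
Proof.
move=> cf; split; first by exists 0; exact: below0.
have [N fN] := compact_continuous_bound cT cf.1.
exists (C * N%:R) => _ [g [cg gf] <-].
apply: le_trans (ler_norm _) _; apply: phi_bound => [|x]; first exact: cg.1.
rewrite ger0_norm ?(cg.2)// (le_trans (gf x))// (le_trans _ (fN x))//.
exact: ler_norm.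
Qed.

Lemma positive_part_ge0 f : cont_ge0 f -> 0 <= positive_part f.
Proof.
by move=> cf; apply: ub_le_sup; [exact: (below_sup cf).2|exact: below0].
Qed.

Lemma positive_part_ge f : cont_ge0 f -> phi f <= positive_part f.
Proof. by move=> cf; apply: ub_le_sup; [exact: (below_sup cf).2|exists f]. Qed.

(** Additivity is the Riesz decomposition property: a function h with
    0 <= h <= f + g is the sum of min h f, which is below f, and of
    h - min h f, which is below g. *)
Lemma positive_partD f g : cont_ge0 f -> cont_ge0 g ->
  positive_part (fun x => f x + g x) = positive_part f + positive_part g.
Proof.
move=> cf cg; rewrite /positive_part -sup_sumE; [|exact: below_sup..].
congr sup; apply/seteqP; split.
  move=> _ [h [ch hfg] <-].
  pose k x := Num.min (h x) (f x).
  have ck : cont_ge0 k by exact: cont_ge0_min.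
  have kh x : k x <= h x by rewrite /k ge_min lexx.
  have chk := cont_ge0B ch ck kh.
  exists (phi k).
    by exists k => //; split => // x; rewrite /k ge_min lexx orbT.
  exists (phi (fun x => h x - k x)).
    exists (fun x => h x - k x) => //; split => // x.
    rewrite lerBlDr /k; case: (lerP (h x) (f x)) => _.
      by rewrite lerDr cg.2.
    by rewrite addrC.
  rewrite -phiD; [|exact: ck.1|exact: chk.1].
  by congr phi; apply/funext => x; rewrite addrC subrK.
move=> _ [_ [h [ch hf] <-] [_ [k [ck kg] <-] <-]].
exists (fun x => h x + k x); last by rewrite phiD//; [exact: ch.1|exact: ck.1].
by split; [exact: cont_ge0D|move=> x; exact: lerD].
Qed.

End positive_part.

Lemma compact_continuous_integrable (R : realType) (T : pseudoPMetricType R)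
    (mu : {measure set (borel T) -> \bar R}) (f : T -> R) :
  compact [set: T] -> (mu setT < +oo)%E -> continuous f ->
  mu.-integrable setT (EFin \o f).
Proof.
move=> cT mufin cf; apply: measurable_bounded_integrable => //.
  exact: continuous_borel.
have [N fN] := compact_continuous_bound cT cf.
exists N%:R; split => // M NM x _ /=.
by rewrite (le_trans (fN x))// ltW.
Qed.

Theorem riesz_signed (R : realType) (T : pseudoPMetricType R)
    (phi : (T -> R) -> R) (C : R) : compact [set: T] ->
  (forall f g, continuous f -> continuous g ->
    phi (fun x => f x + g x) = phi f + phi g) ->
  (forall f M, continuous f -> (forall x, `|f x| <= M) -> `|phi f| <= C * M) ->
  exists m1 m2 : {measure set (borel T) -> \bar R},
  [/\ (m1 setT < +oo)%E, (m2 setT < +oo)%E &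
    forall f, continuous f -> phi f = \int[m1]_x f x - \int[m2]_x f x].
Proof.
move=> cT phiD phib.
have pge0 := positive_part_ge0 phiD phib cT.
have pD := positive_partD phiD phib cT.
have [|m1 [m1fin m1E]] := riesz_positive pge0 _ cT.
  by move=> f g cf cg; rewrite pD.
have [|||m2 [m2fin m2E]] :=
  @riesz_positive R T (fun f => positive_part phi f - phi f).
- by move=> f cf; rewrite subr_ge0; exact: (positive_part_ge phiD phib cT cf).
- move=> f g cf cg; rewrite pD// phiD; [|exact: cf.1|exact: cg.1].
  by rewrite opprD addrACA.
- exact: cT.
exists m1, m2; split => // f cf.
have i1 g : continuous g -> m1.-integrable setT (EFin \o g).
  exact: compact_continuous_integrable.
have i2 g : continuous g -> m2.-integrable setT (EFin \o g).
  exact: compact_continuous_integrable.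
have phiE g : cont_ge0 g -> phi g = \int[m1]_x g x - \int[m2]_x g x.
  by move=> cg; rewrite /Rintegral m1E// m2E//= opprB addrC subrK.
have [N fN] := compact_continuous_bound cT cf.
have cN : @cont_ge0 R T (fun=> N%:R) by exact: cont_ge0_cst.
(* Adding a constant reduces the claim to nonnegative functions. *)
have cfN : cont_ge0 (fun x => f x + N%:R).
  split => [x|x]; first by apply: cvgD; [exact: cf|exact: cN.1].
  by rewrite -lerBlDr sub0r; have := fN x; rewrite ler_norml => /andP[].
have := phiE _ cfN; rewrite phiD//; last exact: cN.1.
rewrite (phiE _ cN) !RintegralD//;
  [|by [exact: i1|exact: i2|exact: i1 cN.1|exact: i2 cN.1]..].
by rewrite opprD addrACA => /addIr.
Qed.

Lemma finite_measure_fin_num d (T : measurableType d) (R : realType)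
    (m : {measure set T -> \bar R}) A : (m setT < +oo)%E -> measurable A ->
  m A \is a fin_num.
Proof.
move=> mfin mA; rewrite ge0_fin_numE// (le_lt_trans _ mfin)//.
by apply: le_measure; rewrite ?inE.
Qed.

(** * Integration against a difference of two measures *)

Section charge_integral.
Context d (T : measurableType d) (R : realType).
Implicit Types nu : {charge set T -> \bar R}.
Implicit Types m : {measure set T -> \bar R}.
Local Open Scope ereal_scope.

Lemma charge_pos_fin nu A : measurable A -> charge_pos nu A \is a fin_num.
Proof. by move=> mA; exact: fin_num_measure. Qed.

Lemma charge_neg_fin nu A : measurable A -> charge_neg nu A \is a fin_num.
Proof. by move=> mA; exact: fin_num_measure. Qed.

Lemma charge_posB nu A : measurable A ->
  nu A = charge_pos nu A - charge_neg nu A.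
Proof.
move=> mA.
by rewrite (jordan_decomp (svalP (hahn_pair nu)) mA) /cadd /= cscaleN1.
Qed.

Lemma charge_sub m1 m2 : m1 setT < +oo -> m2 setT < +oo ->
  exists nu, forall A, nu A = m1 A - m2 A.
Proof.
move=> m1fin m2fin.
have fin m : m setT < +oo -> fin_num_fun m.
  by move=> mfin A; exact: finite_measure_fin_num.
pose nu : set T -> \bar R := fun A => m1 A - m2 A.
have nu0 : nu set0 = 0 by rewrite /nu !measure0 sube0.
have nufin : fin_num_fun nu.
  by move=> A mA; rewrite fin_numB !fin.
have nusa : semi_sigma_additive nu.
  move=> F mF tF mUF.
  rewrite (_ : (fun n => _) =
    (fun n => \sum_(0 <= i < n) m1 (F i) - \sum_(0 <= i < n) m2 (F i))).
    apply: cvgeB; [by rewrite fin_num_adde_defr// fin| |];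
      exact: measure_semi_sigma_additive.
  apply/funext => n; rewrite /nu big_split/= sumeN// => i j _ _.
  by rewrite fin_num_adde_defr// fin.
pose Nu : {charge set T -> \bar R} := HB.pack nu
  (isCharge.Build _ T R nu nu0 nufin nusa).
by exists Nu.
Qed.

(** The Jordan decomposition of nu need not be (m1, m2), but pos + m2 and
    m1 + neg are the same measure. *)
Lemma charge_integral_sub nu m1 m2 (f : T -> R) :
  m1 setT < +oo -> m2 setT < +oo -> measurable_fun setT f ->
  [bounded f x | x in [set: T]] ->
  (forall A, measurable A -> nu A = m1 A - m2 A) ->
  charge_integral nu f = (\int[m1]_x f x - \int[m2]_x f x)%R.
Proof.
move=> m1fin m2fin mf bf nuE.
have ifin m : m setT < +oo -> m.-integrable setT (EFin \o f).
  by move=> mfin; exact: measurable_bounded_integrable.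
have mfE : measurable_fun setT (EFin \o f) by exact/measurable_EFinP.
have posfin : charge_pos nu setT < +oo by rewrite ltey_eq charge_pos_fin.
have negfin : charge_neg nu setT < +oo by rewrite ltey_eq charge_neg_fin.
have : \int[measure_add (charge_pos nu) m2]_x (EFin \o f) x =
       \int[measure_add m1 (charge_neg nu)]_x (EFin \o f) x.
  apply: eq_measure_integral => A mA _.
rewrite [LHS]measure_addE [RHS]measure_addE.
  have := nuE A mA; rewrite charge_posB//.
  rewrite -(fineK (charge_pos_fin nu mA)) -(fineK (charge_neg_fin nu mA)).
  rewrite -(fineK (finite_measure_fin_num m1fin mA)).
  rewrite -(fineK (finite_measure_fin_num m2fin mA)) -!EFinB -!EFinD => -[h].
  by congr _%:E; apply/eqP; rewrite -subr_eq -addrAC h subrK.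
rewrite !integral_measure_add//; [|exact: ifin..].
rewrite /charge_integral /Rintegral.
have fi m : m setT < +oo -> \int[m]_x (EFin \o f) x \is a fin_num.
  by move=> mfin; apply: integrable_fin_num => //; exact: ifin.
rewrite -(fineK (fi _ posfin)) -(fineK (fi _ negfin)).
rewrite -(fineK (fi _ m1fin)) -(fineK (fi _ m2fin)).
rewrite -!EFinD => -[h]; apply/eqP.
by rewrite subr_eq addrAC -h addrK.
Qed.

End charge_integral.

(** * Uniqueness of the representing measure *)

Section borel_measures.
Context {R : realType} {T : pseudoPMetricType R}.
Implicit Types m : {measure set (borel T) -> \bar R}.
Local Open Scope ereal_scope.

(** The integrals of the functions steep h n increase to the measure of the
    open set where h is positive. *)
Lemma borel_measure_unique m1 m2 : m1 setT < +oo ->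
  (forall f : T -> R, cont_ge0 f ->
    \int[m1]_x (f x)%:E = \int[m2]_x (f x)%:E) ->
  forall A, measurable A -> m1 A = m2 A.
Proof.
move=> m1fin m12.
have openE (U : set T) : open U -> m1 U = m2 U.
  move=> oU; have mU := open_borel oU.
  have [h ch Uh] := open_cozero oU.
  have E m : m U = limn (fun n => \int[m]_x (steep h n x)%:E).
    rewrite -(setIT U) -integral_indic// -monotone_convergence//.
    - apply: eq_integral => x _; apply/esym/cvg_lim => //; apply: cvg_near_cst.
      have [hx|hx] := ltP 0%R (h x).
        have [N NP] := steep_eq1 hx; exists N => // n Nn; rewrite NP//.
        by rewrite indicE mem_set// Uh.
      apply: nearW => n; rewrite steep_eq0.
        by rewrite indicE memNset// Uh /=; apply/negP; rewrite -leNgt.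
      by apply/eqP; rewrite eq_le hx ch.2.
    - move=> n; apply/measurable_EFinP.
      exact: (continuous_borel (steep_cont_ge0 ch n).1).
    - by move=> n x _; rewrite lee_fin (steep_cont_ge0 ch n).2.
    - by move=> x _ a b ab; rewrite lee_fin steep_nd.
  rewrite !E; congr (limn _); apply/funext => n; apply: m12.
  exact: steep_cont_ge0.
move=> A mA.
apply: (@measure_unique _ _ (borel T) (@open T) (fun=> setT)) => //.
- by move=> U V; exact: openI.
- by move=> _; exact: openT.
- by apply/seteqP; split => // x _; exists 0%N.
Qed.

Lemma charge_unique (nu mu : {charge set (borel T) -> \bar R}) :
  compact [set: T] ->
  (forall f : T -> R, continuous f ->
    charge_integral nu f = charge_integral mu f) ->
  forall A, measurable A -> nu A = mu A.
Proof.
move=> cT numu A mA.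
have fin0 (k : {charge set (borel T) -> \bar R}) : charge_pos k setT < +oo.
  by rewrite ltey_eq charge_pos_fin.
have fin1 (k : {charge set (borel T) -> \bar R}) : charge_neg k setT < +oo.
  by rewrite ltey_eq charge_neg_fin.
have : measure_add (charge_pos nu) (charge_neg mu) A =
       measure_add (charge_pos mu) (charge_neg nu) A.
  apply: borel_measure_unique => //.
    by rewrite [ltLHS]measure_addE; exact: lte_add_pinfty.
  move=> f cf.
  have int m : m setT < +oo -> \int[m]_x (f x)%:E \is a fin_num.
    move=> mfin; apply: integrable_fin_num => //.
    exact: (compact_continuous_integrable cT mfin cf.1).
  have mf : measurable_fun [set: borel T] (fun x => (f x)%:E).
    by apply/measurable_EFinP; exact: (continuous_borel cf.1).
  have f0 (x : borel T) : setT x -> 0 <= (f x)%:E by rewrite lee_fin cf.2.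
  rewrite !ge0_integral_measure_add//.
  have := numu f cf.1; rewrite /charge_integral /Rintegral.
  rewrite -[in X in _ -> X](fineK (int _ (fin0 nu))).
  rewrite -[in X in _ -> X](fineK (int _ (fin0 mu))).
  rewrite -[in X in _ -> X](fineK (int _ (fin1 nu))).
  rewrite -[in X in _ -> X](fineK (int _ (fin1 mu))).
  move=> h; rewrite -!EFinD; congr _%:E.
  by apply/eqP; rewrite -subr_eq addrAC h subrK.
rewrite [X in X = _ -> _]measure_addE [X in _ = X -> _]measure_addE.
rewrite (charge_posB nu)// (charge_posB mu)//.
rewrite -(fineK (charge_pos_fin nu mA)) -(fineK (charge_neg_fin nu mA)).
rewrite -(fineK (charge_pos_fin mu mA)) -(fineK (charge_neg_fin mu mA)).
rewrite -!EFinD => -[h]; congr _%:E.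
by apply/eqP; rewrite subr_eq addrAC -h addrK.
Qed.

End borel_measures.

(** * Regularity of finite Borel measures *)

Section regularity.
Context {R : realType} {T : pseudoPMetricType R}.
Variable m : {measure set (borel T) -> \bar R}.
Hypothesis mfin : (m setT < +oo)%E.
Local Open Scope ereal_scope.

Definition sandwiched (A : set T) := forall e : R, (0 < e)%R ->
  exists K U : set T, [/\ closed K, open U, K `<=` A, A `<=` U &
    m (U `\` K) <= e%:E].

(* Finiteness of m gives continuity from above. *)
Let cvg_small (F : nat -> set (borel T)) (e d : R) : (d < e)%R ->
  (forall n, measurable (F n)) -> {homo F : n k / (n <= k)%N >-> (k <= n)%O} ->
  m (\bigcap_n F n) <= d%:E -> exists n, m (F n) <= e%:E.
Proof.
move=> de mF niF mFd.
have mcap : measurable (\bigcap_n F n) by exact: bigcapT_measurable.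
have F0 : m (F 0%N) < +oo by rewrite ltey_eq finite_measure_fin_num.
have := nonincreasing_cvg_mu F0 mF mcap niF.
have le : m (\bigcap_n F n) < e%:E by rewrite (le_lt_trans mFd)// lte_fin.
have oe : nbhs (m (\bigcap_n F n)) [set y | y < e%:E].
  by apply: open_nbhs_nbhs; split => //; exact: open_ereal_lt_ereal.
by move=> /(_ _ oe)[N _ /(_ N (leqnn N))/= /ltW mN]; exists N.
Qed.

(** An open set [set x | 0 < h x] is the increasing union of the closed sets
    [set x | 1 <= n h x]. *)
Lemma open_sandwiched (U : set T) : open U -> sandwiched U.
Proof.
move=> oU e e0; have [h ch Uh] := open_cozero oU.
pose K n : set T := [set x | 1 <= n%:R * h x]%R.
have cK n : closed (K n).
  apply: (preimage_closed _ (@closed_ge _ 1%R)) => x _.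
  exact: (cont_ge0M (cont_ge0_cst (ler0n R n)) ch).1.
have KU n : K n `<=` U.
  move=> x; rewrite Uh /K /= => nh; rewrite lt0r ch.2 andbT.
  by apply/eqP => hx; move: nh; rewrite hx mulr0 ler10.
have capK : \bigcap_n (U `\` K n) = set0.
  apply/seteqP; split => // x Kx; have [Ux _] := Kx 0%N I.
  rewrite Uh /= in Ux; have [N /(_ N (leqnn N)) NP] := steep_eq1 Ux.
  have [_] := Kx N I; apply.
  by rewrite /K /= -[leLHS]NP /steep ge_min lexx orbT.
have [|||n mn] := @cvg_small (fun n => U `\` K n) e 0 e0.
- move=> n; apply: measurableD; [exact: open_borel|exact: closed_borel].
- move=> n k nk; apply/subsetPset => x [Ux nKx]; split => //.
  apply: contra_not nKx.
  by rewrite /K /= => /le_trans; apply; rewrite ler_wpM2r ?ch.2// ler_nat.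
- by rewrite capK measure0.
by exists (K n), U; split.
Qed.

(** For a countable union, the open sets are united, with errors bounded by a
    geometric series; only finitely many of the closed sets can be united, and
    continuity from above makes the loss small. *)
Lemma borel_sandwiched (A : set (borel T)) : measurable A -> sandwiched A.
Proof.
move: A; apply: smallest_sub; last exact: open_sandwiched.
split.
- move=> e e0; exists set0, set0; split => //; first exact: closed0.
    exact: open0.
  by rewrite setD0 measure0 lee_fin ltW.
- move=> A sA e e0; have [K [U [cK oU KA AU mUK]]] := sA e e0.
  exists (~` U), (~` K); split.
  + by rewrite closedC.
  + by rewrite openC.
  + by rewrite setTD; exact: subsetC.
  + by rewrite setTD; exact: subsetC.
  + by rewrite setDE setCK setIC -setDE.
- move=> A sA e e0; have e20 : (0 < e / 2)%R by rewrite divr_gt0.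
  have /choice[K KP] n : exists K, exists U, [/\ closed K, open U, K `<=` A n,
      A n `<=` U & m (U `\` K) <= (e / 2 / (2 ^ n.+1)%:R)%:E].
    by apply: sA; rewrite divr_gt0// ltr0n expn_gt0.
  have /choice[U UP] := KP.
  have cK n : closed (K n) by have [] := UP n.
  have oU n : open (U n) by have [] := UP n.
  pose V := \bigcup_n U n.
  have oV : open V by exact: bigcup_open.
  pose C n := \bigcup_(i in `I_n) K i.
  have cC n : closed (C n) by apply: closed_bigcup.
  have mUK n : measurable (U n `\` K n : set (borel T)).
    by apply: measurableD; [exact: open_borel|exact: closed_borel].
  have [||||n mn] := @cvg_small (fun n => V `\` C n) e (e / 2).
  + by rewrite ltr_pdivrMr// ltr_pMr// ltr1n.
  + by move=> n; apply: measurableD; [exact: open_borel|exact: closed_borel].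
  + move=> n k nk; apply/subsetPset => x [Vx nCx]; split => //.
    apply: contra_not nCx => -[i /= ik Kix]; exists i => //=.
    exact: leq_trans nk.
  + have sub : \bigcap_n (V `\` C n) `<=` \bigcup_n (U n `\` K n).
      move=> x VCx; have [[i _ Uix] _] := VCx 0%N I.
      exists i => //; split => // Kix; have [_] := VCx i.+1 I; apply.
      by exists i => /=.
    have mcap : measurable (\bigcap_n (V `\` C n) : set (borel T)).
      apply: bigcapT_measurable => n.
      by apply: measurableD; [exact: open_borel|exact: closed_borel].
    apply: le_trans (measure_sigma_subadditive m mUK mcap sub) _.
    apply: (@le_trans _ _ (\sum_(n <oo) (0 + (e / 2 / (2 ^ n.+1)%:R)%:E))).
      by apply: lee_nneseries => // n _; rewrite add0e; have [] := UP n.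
    apply: le_trans (epsilon_trick xpredT _ (ltW e20)) _ => //.
    by rewrite eseries0// add0e.
  exists (C n), V; split => //.
  + move=> x [i _ Kix]; exists i => //; have [_ _ + _ _] := UP i.
    exact.
  + move=> x [i _ Aix]; exists i => //; have [_ _ _ + _] := UP i.
    exact.
Qed.

Lemma compact_regular_measure : compact [set: T] -> hausdorff_space T ->
  forall A : set (borel T), measurable A ->
    m A = ereal_sup [set m K | K in [set K : set T | compact K /\ K `<=` A]] /\
    m A = ereal_inf [set m U | U in [set U : set T | open U /\ A `<=` U]].
Proof.
move=> cT hT A mA; split; apply/eqP; rewrite eq_le; apply/andP; split.
- apply/lee_addgt0Pr => e e0.
  have [K [U [cK oU KA AU mUK]]] := borel_sandwiched mA e0.
  have mK := closed_borel cK; have mU := open_borel oU.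
  apply: (@le_trans _ _ (m K + m (U `\` K))).
    rewrite -measureU//; [|exact: measurableD|by rewrite setDIK].
    apply: le_measure; rewrite ?inE//.
      by apply: measurableU => //; exact: measurableD.
    by rewrite setDUK//; exact: subset_trans AU.
  apply: leeD => //; apply: ereal_sup_ubound; exists K => //; split => //.
  exact: subclosed_compact cT _.
- apply: ge_ereal_sup => _ [K [cK KA] <-]; apply: le_measure; rewrite ?inE//.
  by apply: closed_borel; exact: compact_closed.
- apply: le_ereal_inf_tmp => _ [U [oU AU] <-].
  apply: le_measure; rewrite ?inE//.
  exact: open_borel.
- apply/lee_addgt0Pr => e e0.
  have [K [U [cK oU KA AU mUK]]] := borel_sandwiched mA e0.
  have mK := closed_borel cK; have mU := open_borel oU.
  apply: (@le_trans _ _ (m U)).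
    by apply: ereal_inf_lbound; exists U.
  rewrite -(setDUK (subset_trans KA AU)) measureU//;
    [|exact: measurableD|by rewrite setDIK].
  by apply: leeD => //; apply: le_measure; rewrite ?inE.
Qed.

End regularity.

(** * The compact space [0, +oo] *)

Section eRplus_topology.
Context {R : realType}.

Lemma eRplus_hausdorff : hausdorff_space (eRplus R).
Proof.
move=> p q pq; apply: val_inj; apply: (@ereal_hausdorff R) => A B nA nB.
have cv := @initial_continuous _ _ (set_val : eRplus R -> \bar R).
have [t [At Bt]] := pq _ _ (cv p A nA) (cv q B nB).
by exists (val t).
Qed.

Let clamp (s : R) : R := Num.max 0 (Num.min s 1).

Let clamp_norm s : `|clamp s| <= 1.
Proof.
rewrite ger0_norm ?le_max ?lexx//.
by rewrite ge_max ler01 ge_min lexx orbT.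
Qed.

Let clamp_cont : continuous clamp.
Proof.
move=> s; apply: (@continuous_max R R (fun=> 0) _ s).
  exact: cst_continuous.
by apply: (@continuous_min R R id _ s) => //; exact: cst_continuous.
Qed.

(** The metric of the extended real line is that of its image [-1, 1] under
    contract, so [0, +oo] is a continuous image of [0, 1] under expand; the
    clamping extends expand to all of R. *)
Lemma eRplus_compact : compact [set: eRplus R].
Proof.
have p s : (0 <= expand (clamp s))%E.
  by rewrite -le_contract contract0 expandK ?inE// /clamp le_max lexx.
pose g (s : R) : eRplus R := eRplus_of (p s).
have gE s : contract (val (g s)) = clamp s by rewrite /g /= expandK// inE.
have cg : continuous g.
  move=> s A /nbhs_ballP[e /= e0 gsA].
  have /cvgrPdist_lt/(_ e e0) := @clamp_cont s.
  apply: filterS => t st; apply: gsA.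
  by move: st; rewrite /= -!gE; exact: id.
rewrite (_ : setT = g @` `[0, 1]); last first.
  apply/seteqP; split => // t _; exists (contract (val t)).
    rewrite /= in_itv/= -[in X in X && _](contract0 R).
    rewrite le_contract (set_mem (valP t)).
    exact: (le_trans (ler_norm _) (contract_le1 _)).
  apply: val_inj; apply: contract_inj; rewrite gE /clamp min_l.
    by rewrite max_r// -(contract0 R) le_contract (set_mem (valP t)).
  exact: (le_trans (ler_norm _) (contract_le1 _)).
apply: continuous_compact; last exact: segment_compact.
exact: continuous_subspaceT.
Qed.

End eRplus_topology.

(** * Functions with a limit at +oo and continuous functions on [0, +oo] *)

Section Clim_vs_continuous.
Context {R : realType} {n : nat}.
Implicit Types (f g : eRplus R -> R) (x : Clim R n).

Let val_cont : continuous (val : eRplus R -> \bar R).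
Proof. exact: (@initial_continuous _ _ (set_val : eRplus R -> \bar R)). Qed.

Lemma eRplus_fin_continuous : continuous (@eRplus_fin R).
Proof.
move=> t A [B [[V oV <-] /= Vt] VA].
have cv : continuous (fun s : Rplus R => (val s)%:E).
  move=> s; apply: (@continuous_comp _ _ _ (val : Rplus R -> R) EFin).
    exact: (@initial_continuous _ _ (set_val : Rplus R -> R)).
  by move=> D.
have := cv t V; rewrite nbhs_filterE => /(_ _)[|].
  by apply: open_nbhs_nbhs; split.
move=> C [oC Ct CV]; exists C; split => // s /CV /= Vs.
exact: VA.
Qed.

Lemma eRplus_fin_oo : eRplus_fin t @[t --> at_oo R] --> (@eRplus_oo R).
Proof.
move=> A [B [[V oV <-] /= Voo] VA].
have [M [_ MV]] : nbhs (+oo%E : \bar R) V by apply: open_nbhs_nbhs; split.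
by exists M => // t /= Mt; apply: VA; apply: MV; rewrite /= lte_fin.
Qed.

Lemma eRplus_cases (t : eRplus R) :
  (exists s : Rplus R, t = eRplus_fin s) \/ t = eRplus_oo.
Proof.
have [[r r0 tr]|too] := eRplusP t; [left|right]; last exact: val_inj.
by exists (Rplus_of r0); apply: val_inj.
Qed.

(** At +oo, continuity is the existence of the limit. *)
Lemma Clim_ext_continuous x : continuous (Clim_ext x).
Proof.
move=> t; have [[p ->]|->] := eRplus_cases t => A;
  rewrite ?Clim_ext_fin ?Clim_ext_oo.
  move=> /(@Clim_continuous _ _ x p)[B [[V oV <-] /= Vp] VA].
  have nS : nbhs ((val p)%:E : \bar R) [set y | exists2 s, y = s%:E & V s].
    have : nbhs (val p : R) V by apply: open_nbhs_nbhs; split.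
    by apply: filterS => s Vs /=; exists s.
  apply: (@filterS _ (nbhs (eRplus_fin p)) _ _ _ _
    (@val_cont (eRplus_fin p) _ nS)) => u [s us Vs].
  have [[q uq]|uoo] := eRplus_cases u; last by move: us; rewrite uoo.
  rewrite uq /= Clim_ext_fin; apply: VA => /=.
  by move: us Vs; rewrite uq => -[<-].
move=> nA; have [M _ MA] := Clim_cvg nA.
apply: (@filterS _ (nbhs (@eRplus_oo R)) _ _ _ _
  (@val_cont eRplus_oo _ (nbhs_open_ereal_pinfty M))) => u Mu.
have [[q uq]|->] := eRplus_cases u.
  by rewrite /= uq Clim_ext_fin; apply: MA; move: Mu; rewrite uq /= lte_fin.
by rewrite /= Clim_ext_oo; exact: nbhs_singleton.
Qed.

Lemma Clim_ext_coord_continuous x i : continuous (fun t => Clim_ext x t 0 i).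
Proof.
move=> s.
apply: (@continuous_comp _ _ _ (Clim_ext x) (fun v : 'rV[R]_n => v 0 i)).
  exact: Clim_ext_continuous.
exact: coord_continuous.
Qed.

Variable i : 'I_n.

(** The default value 0 only matters when f is not continuous; making this a
    total function of f gives a functional on all functions. *)
Definition Clim_axis f : Clim R n :=
  insubd 0 (fun t : Rplus R => f (eRplus_fin t) *: delta_mx 0 i).

Let axis_cvg_oo f : continuous f ->
  (f (eRplus_fin s) *: (delta_mx 0 i : 'rV[R]_n)) @[s --> at_oo R]
    --> f eRplus_oo *: (delta_mx 0 i : 'rV[R]_n).
Proof.
move=> cf; apply: cvgZr_tmp; apply: cvg_comp eRplus_fin_oo _.
exact: cf.
Qed.

Lemma Clim_axisE f t : continuous f ->
  Clim_axis f t = f (eRplus_fin t) *: delta_mx 0 i.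
Proof.
move=> cf; rewrite -[LHS]/(Clim_fun _ t) /Clim_axis.
have P : (fun t : Rplus R => f (eRplus_fin t) *: (delta_mx 0 i : 'rV[R]_n)) \in
    @Clim_pred R n.
  rewrite inE; split.
    have cff : continuous (f \o @eRplus_fin R).
      move=> s; apply: (@continuous_comp _ _ _ (@eRplus_fin R) f).
        exact: eRplus_fin_continuous.
      exact: cf.
    move=> s; apply: cvgZr_tmp; first exact: (nbhs_filter s).
    exact: cff.
  by apply/cvg_ex; exists (f eRplus_oo *: delta_mx 0 i); exact: axis_cvg_oo.
by rewrite -[Clim_fun _]/(val _) (insubdK _ P).
Qed.

Lemma Clim_ext_axis f t : continuous f ->
  Clim_ext (Clim_axis f) t = f t *: delta_mx 0 i.
Proof.
move=> cf; have [[p ->]|->] := eRplus_cases t.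
  by rewrite Clim_ext_fin Clim_axisE.
rewrite Clim_ext_oo /Clim_lim; apply/cvg_lim => //.
rewrite (_ : (fun t => _) = (fun t => f (eRplus_fin t) *: delta_mx 0 i)).
  exact: axis_cvg_oo.
by apply/funext => s; exact: Clim_axisE.
Qed.

Lemma Clim_axisD f g : continuous f -> continuous g ->
  Clim_axis (fun t => f t + g t) = Clim_axis f + Clim_axis g.
Proof.
move=> cf cg; apply: ClimP => t.
rewrite -[RHS]/(Clim_axis f t + Clim_axis g t) !Clim_axisE//.
  by rewrite scalerDl.
by move=> s; exact: (@continuousD _ _ _ f g s (cf s) (cg s)).
Qed.

Lemma Clim_axis_norm f M : continuous f -> (forall t, `|f t| <= M) ->
  `|Clim_axis f| <= M * `|delta_mx 0 i : 'rV[R]_n|.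
Proof.
move=> cf fM; apply: Clim_norm_le => t.
by rewrite Clim_axisE// normrZ ler_wpM2r.
Qed.

End Clim_vs_continuous.

Lemma Clim_sum_axis (R : realType) (n : nat) (x : Clim R n) :
  x = \sum_(i < n) Clim_axis i (fun t => Clim_ext x t 0 i).
Proof.
apply: ClimP => t.
have cx := @Clim_ext_coord_continuous _ _ x.
have sumE (F : 'I_n -> Clim R n) :
    (\sum_(i < n) F i : Clim R n) t = \sum_(i < n) F i t.
  by elim/big_rec2 : _ => // i y1 y2 _ <-.
rewrite sumE; under eq_bigr do rewrite Clim_axisE//.
by rewrite -Clim_ext_fin [LHS]row_sum_delta.
Qed.

Lemma charge_integral0 d (T : measurableType d) (R : realType)
    (nu : {charge set T -> \bar R}) : charge_integral nu (fun=> 0) = 0.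
Proof. by rewrite /charge_integral /Rintegral !integral0 subrr. Qed.

Lemma Clim_integral_axis (R : realType) (n : nat)
    (nu : 'I_n -> {charge set (eRplus R) -> \bar R}) i f : continuous f ->
  Clim_integral nu (Clim_axis i f) = charge_integral (nu i) f.
Proof.
move=> cf; rewrite /Clim_integral (bigD1 i)//= big1 ?addr0 => [|j ji].
  congr charge_integral; apply/funext => t.
  by rewrite Clim_ext_axis// !mxE !eqxx mulr1.
rewrite -[RHS](charge_integral0 (nu j)).
congr charge_integral; apply/funext => t.
by rewrite Clim_ext_axis// !mxE eqxx (negbTE ji) mulr0.
Qed.

Lemma eRplus_regular_charge (R : realType)
    (nu : {charge set (eRplus R) -> \bar R}) :
  regular_charge nu.
Proof.
move=> A mA; apply: (@compact_regular_measure R (eRplus R)) => //.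
- rewrite ltey_eq; apply/orP; left.
  have := fin_num_measure (charge_variation (svalP (hahn_pair nu))).
  by apply.
- exact: eRplus_compact.
- exact: eRplus_hausdorff.
Qed.

Unset Implicit Arguments.

(* Charges may take arbitrary values on non-measurable sets, so uniqueness is
   equality on all Borel sets. *)
Theorem lemma4p3 (R : realType) (n : nat) (n_gt0 : (0 < n)%N)
    (phi : {linear Clim R n -> R^o}) (phi_continuous : continuous phi) :
  exists mu : 'I_n -> {charge set (eRplus R) -> \bar R},
    [/\ forall i, regular_charge (mu i),
        forall x : Clim R n, phi x = Clim_integral mu x &
        forall nu : 'I_n -> {charge set (eRplus R) -> \bar R},
          (forall i, regular_charge (nu i)) ->
          (forall x : Clim R n, phi x = Clim_integral nu x) ->
          forall (i : 'I_n) (A : set (eRplus R)),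
            measurable A -> nu i A = mu i A].
Proof.
have cT := @eRplus_compact R.
have /linear_boundedP[r0 [_ rP]] :=
  (linear_bounded_continuous phi).2 phi_continuous.
pose r := `|r0| + 1.
have phir x : `|phi x| <= r * `|x|.
  by apply: rP; rewrite (le_lt_trans (ler_norm _))// ltrDl.
have /choice[mu muP] i : exists mu : {charge set (eRplus R) -> \bar R},
    forall f, continuous f -> phi (Clim_axis i f) = charge_integral mu f.
  have [||m1 [m2 [m1fin m2fin phiE]]] :=
      @riesz_signed R (eRplus R) (fun f => phi (Clim_axis i f))
        (r * `|delta_mx 0 i : 'rV[R]_n|) cT.
  - by move=> f g cf cg; rewrite Clim_axisD// linearD.
  - move=> f M cf fM; apply: le_trans (phir _) _.
    by rewrite -mulrA [_ * M]mulrC ler_wpM2l ?addr_ge0// Clim_axis_norm.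
  have [mu muE] := charge_sub m1fin m2fin.
  exists mu => f cf; rewrite phiE//; apply/esym.
  apply: (@charge_integral_sub _ (borel (eRplus R))) => //.
    exact: continuous_borel.
  have [N fN] := compact_continuous_bound cT cf.
  exists N%:R; split => // M NM x _ /=.
  by rewrite (le_trans (fN x))// ltW.
exists mu; split.
- by move=> i; exact: eRplus_regular_charge.
- move=> x; rewrite [in LHS](Clim_sum_axis x) linear_sum.
  by apply: eq_bigr => i _; apply: muP; exact: Clim_ext_coord_continuous.
- move=> nu _ nuE i; apply: charge_unique cT _ => f cf.
  by rewrite -muP// nuE Clim_integral_axis.
Qed.
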